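(* For every integer $n\ge1$, the order type of $(OT_n[0],<)$ is $\omega_{2n-1}$.
   Context: $\omega_0:=1$ and $\omega_{k+1}:=\omega^{\omega_k}$ (so $\omega_1=\omega$, $\omega_3=\omega^{\omega^\omega}$). $OT_n$ is the least set of formal terms, with a function $S$, such that: $0\in OT_n$ with $S(0):=-1$; and if $\alpha,\beta\in OT_n$, $0\le i<n$, $S(\alpha)\le i+1$, $S(\beta)\le i$, and no symbol $\overline{\theta}_j$ with $j\le i$ occurs in $\alpha$ (in the paper: $K_i\alpha=\emptyset$), then $\overline{\theta}_i\alpha\beta\in OT_n$ with $S(\overline{\theta}_i\alpha\beta):=i$. The ordering $<$ on $OT_n$ (with $\le$ meaning $<$ or $=$) is defined recursively by: $0<\overline{\theta}_i\alpha\beta$ always; and $\overline{\theta}_i\alpha\beta<\overline{\theta}_j\gamma\delta$ iff either $i<j$, or $i=j$ and one of the following holds: (a) $\alpha<\gamma$ and $\beta<\overline{\theta}_i\gamma\delta$; (b) $\alpha=\gamma$ and $\beta<\delta$; (c) $\alpha>\gamma$ and $\overline{\theta}_i\alpha\beta\le\delta$. $OT_n[0]:=\{\alpha\in OT_n:S(\alpha)\le0\}$. *)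

(* Defs.v *)
From Stdlib Require Import Arith ZArith.

(** * Ordinals *)

(* [lsup U f] stands for the least ordinal strictly above all the [f i], that
   is, for the set of ordinals that are [<= f i] for some [i].  An ordinal has
   many representations: equality of ordinals is [oeq], not [=]. *)
Inductive ord : Type := lsup (U : Type) (f : U -> ord).

Fixpoint ole (a b : ord) {struct a} : Prop :=
  match a, b with
  | lsup U f, lsup V g => forall i : U, exists j : V, ole (f i) (g j)
  end.

Definition olt (a b : ord) : Prop :=
  match b with lsup J g => exists j : J, ole a (g j) end.

Definition oeq (a b : ord) : Prop := ole a b /\ ole b a.

Definition ozero : ord := lsup Empty_set (fun e => match e with end).
Definition osucc (a : ord) : ord := lsup unit (fun _ => a).
Definition oone : ord := osucc ozero.

Definition index (a : ord) : Type := match a with lsup U _ => U end.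
Definition child (a : ord) : index a -> ord :=
  match a with lsup _ f => f end.

(* Least upper bound (not strict): the union of the [f i]. *)
Definition osup (U : Type) (f : U -> ord) : ord :=
  lsup {i : U & index (f i)} (fun p => child (f (projT1 p)) (projT2 p)).

Fixpoint onat (k : nat) : ord :=
  match k with 0 => ozero | S k => osucc (onat k) end.
Definition omega : ord := lsup nat onat.

(* The usual transfinite recursions, with the zero, successor and limit clauses
   merged into one:
     a + b   = sup ({a} U {(a + d) + 1 : d < b}),
     a * b   = sup {a * d + a : d < b},
     omega^b = sup ({1} U {omega^d * omega : d < b}). *)
Fixpoint oadd (a b : ord) {struct b} : ord :=
  match b with
  | lsup J g => osup (option J) (fun o =>
      match o with None => a | Some j => osucc (oadd a (g j)) end)
  end.

Fixpoint omul (a b : ord) {struct b} : ord :=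
  match b with
  | lsup J g => osup J (fun j => oadd (omul a (g j)) a)
  end.

Fixpoint omega_pow (b : ord) : ord :=
  match b with
  | lsup J g => osup (option J) (fun o =>
      match o with None => oone | Some j => omul (omega_pow (g j)) omega end)
  end.

Fixpoint omega_tower (k : nat) : ord :=
  match k with 0 => oone | S k => omega_pow (omega_tower k) end.

(* The subset [P] of [A], ordered by [R], is isomorphic to the set of ordinals
   below [a], ordered by [olt] (and taken up to [oeq]). *)
Definition has_order_type (A : Type) (P : A -> Prop) (R : A -> A -> Prop)
    (a : ord) : Prop :=
  exists f : A -> ord,
    (forall x, P x -> olt (f x) a) /\
    (forall b, olt b a -> exists x, P x /\ oeq (f x) b) /\
    (forall x y, P x -> P y -> oeq (f x) (f y) -> x = y) /\
    (forall x y, P x -> P y -> (R x y <-> olt (f x) (f y))).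

(** * The notation systems *)

Inductive term : Set :=
| Zero : term
| Theta (i : nat) (alpha beta : term) : term.

Definition Sub (t : term) : Z :=
  match t with Zero => -1 | Theta i _ _ => Z.of_nat i end%Z.

Fixpoint occurs (j : nat) (t : term) : Prop :=
  match t with
  | Zero => False
  | Theta i alpha beta => j = i \/ occurs j alpha \/ occurs j beta
  end.

Inductive OT (n : nat) : term -> Prop :=
| OT_Zero : OT n Zero
| OT_Theta (i : nat) (alpha beta : term) :
    OT n alpha -> OT n beta -> i < n ->
    (Sub alpha <= Z.of_nat i + 1)%Z -> (Sub beta <= Z.of_nat i)%Z ->
    (forall j, j <= i -> ~ occurs j alpha) ->
    OT n (Theta i alpha beta).

(* Defined on all terms at once: the clauses only compare subterms, so it
   restricts to each [OT n].  As every appeal to the order in a premise is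
   positive and concerns a pair of smaller total size, this least relation is
   the one given by recursion. *)
Inductive tlt : term -> term -> Prop :=
| tlt_Zero i alpha beta : tlt Zero (Theta i alpha beta)
| tlt_index i j alpha beta gamma delta :
    i < j -> tlt (Theta i alpha beta) (Theta j gamma delta)
| tlt_fst_lt i alpha beta gamma delta :
    tlt alpha gamma -> tlt beta (Theta i gamma delta) ->
    tlt (Theta i alpha beta) (Theta i gamma delta)
| tlt_fst_eq i alpha beta delta :
    tlt beta delta ->
    tlt (Theta i alpha beta) (Theta i alpha delta)
| tlt_fst_gt_lt i alpha beta gamma delta :
    tlt gamma alpha -> tlt (Theta i alpha beta) delta ->
    tlt (Theta i alpha beta) (Theta i gamma delta)
| tlt_fst_gt_eq i alpha beta gamma :
    tlt gamma alpha ->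
    tlt (Theta i alpha beta) (Theta i gamma (Theta i alpha beta)).

Definition OT0 (n : nat) (t : term) : Prop := OT n t /\ (Sub t <= 0)%Z.

(* Main.v *)
Require Import Defs.
From Stdlib Require Import Arith.
From Stdlib Require Import ZArith Lia Setoid Morphisms Classical ClassicalEpsilon.

(** Let [C_i] be the set of the terms of [OT n] whose leading symbol, if any,
    is [theta_i] and which contain no [theta_j] with [j < i] ([level n i]).
    Thus [C_n = {0}], and a nonzero element of [C_i] is [theta_i alpha beta]
    with [alpha] in [C_(i+1)] and [beta] in [C_i] ([level_Theta]): the elements
    of [C_i] are the finite words over the alphabet [C_(i+1)].  The claim about
    [OT_n[0] = C_0] therefore reduces to one computation: words over a
    well-ordered alphabet of type [a] have some type [words a], with
    [words 1 = omega] and [words a = omega^(omega^a)] for infinite [a].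

    The number [words a] comes from cutting a word at the occurrences of its
    greatest letter, of rank [c] say.  The order first compares the numbers of
    these occurrences, and for equal numbers compares lexicographically,
    rightmost first, the pieces in between, which are words over the letters
    below [c].  So words over the letters up to [c] have as type the supremum
    of the finite powers of [words c] when [words c > 1], and [omega] when
    [words c = 1], which is the case of a one-letter alphabet.

    The isomorphism is defined by recursion on words, without cutting them.
    With [W = words (c+1)], putting a letter of rank [c] in front of a word of
    rank [W * q + z], [z < W], gives a word of rank
    [W * q + words c * (1 + z)] ([prefix]): the summand [W * q] accounts for
    the part of the word from its first letter above [c] on, which is not
    affected.  That this operation is strictly monotone, inflationary, and does
    not cross multiples of [W] ([prefix_smono], [prefix_ogt],
    [prefix_olt_multiple]) are exactly the facts that the clauses of [tlt]
    require, so [tlt] implies the order of ranks ([value_olt]); the converse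
    and injectivity follow because [tlt] is total.  That every nonzero ordinal
    below [words a] arises by prefixing some letter to a smaller one
    ([prefix_surjective]) makes the ranks exhaust [words a]. *)

Declare Scope ord_scope.
Delimit Scope ord_scope with ord.
Infix "<=" := ole : ord_scope.
Infix "<" := olt : ord_scope.
Infix "==" := oeq (at level 70) : ord_scope.
Infix "+" := oadd : ord_scope.
Infix "*" := omul : ord_scope.
Local Open Scope ord_scope.

(** * The well-order of the ordinals *)

Lemma ole_refl a : a <= a.
Proof. induction a as [U f IH]; intros i; exists i; apply IH. Qed.

Lemma ole_trans a b c : a <= b -> b <= c -> a <= c.
Proof.
  revert b c; induction a as [U f IH]; intros [V g] [W h] H1 H2 i.
  destruct (H1 i) as [j Hj]; destruct (H2 j) as [k Hk].
  exists k; eapply IH; eassumption.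
Qed.

Lemma ole_olt_trans a b c : a <= b -> b < c -> a < c.
Proof. destruct c; intros H [j Hj]; exists j; eapply ole_trans; eassumption. Qed.

Lemma olt_ole_trans a b c : a < b -> b <= c -> a < c.
Proof.
  destruct b as [V g]; destruct c as [W h]; intros [j Hj] H.
  destruct (H j) as [k Hk]; exists k; eapply ole_trans; eassumption.
Qed.

Lemma child_olt (U : Type) (f : U -> ord) i : f i < lsup U f.
Proof. exists i; apply ole_refl. Qed.

Lemma olt_ole a b : a < b -> a <= b.
Proof.
  revert a; induction b as [V g IH]; intros [U f] [j Hj] i; exists j.
  apply IH; eapply olt_ole_trans; [apply child_olt | exact Hj].
Qed.

Lemma olt_trans a b c : a < b -> b < c -> a < c.
Proof. intros H1 H2; eapply ole_olt_trans; [apply olt_ole, H1 | exact H2]. Qed.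

Lemma ole_intro a b : (forall x, x < a -> x < b) -> a <= b.
Proof.
  destruct a as [U f]; destruct b as [V g]; intros H i; apply (H (f i)), child_olt.
Qed.

Lemma olt_irrefl a : ~ a < a.
Proof.
  induction a as [U f IH]; intros [i Hi]; apply (IH i).
  eapply olt_ole_trans; [apply child_olt | exact Hi].
Qed.

Lemma ole_not_olt a b : a <= b -> ~ b < a.
Proof. intros H1 H2; apply (olt_irrefl a); eapply ole_olt_trans; eassumption. Qed.

(** Classical logic decides whether some child of [a] is at or above [b]; if
    there is none, all children lie below [b], by induction. *)
Lemma ole_or_olt a b : a <= b \/ b < a.
Proof.
  revert b; induction a as [U f IH]; intros b.
  destruct (classic (exists i, b <= f i)) as [H | H]; [right; exact H | left].
  apply ole_intro; intros x [i Hi]; eapply ole_olt_trans; [exact Hi |].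
  clear x Hi; destruct b as [V g].
  apply NNPP; intros N; apply H; exists i.
  apply ole_intro; intros x [j Hj]; eapply ole_olt_trans; [exact Hj |].
  destruct (IH i (g j)) as [Hle | Hlt]; [| exact Hlt].
  destruct N; exists j; exact Hle.
Qed.

Lemma olt_wf : well_founded olt.
Proof.
  intros b; induction b as [V g IH]; constructor; intros a [j Hj].
  constructor; intros x Hx; apply (IH j); eapply olt_ole_trans; eassumption.
Qed.

Lemma ord_least (P : ord -> Prop) :
  (exists a, P a) -> exists a, P a /\ forall b, b < a -> ~ P b.
Proof.
  intros [a Ha]; induction (olt_wf a) as [a _ IH].
  destruct (classic (exists b, b < a /\ P b)) as [(b & Hlt & Hb) | N].
  - exact (IH b Hlt Hb).
  - exists a; split; [exact Ha | intros b Hlt Hb; apply N; exists b; tauto].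
Qed.

Instance ole_preorder : PreOrder ole.
Proof. split; [exact ole_refl | exact ole_trans]. Qed.

Instance oeq_equivalence : Equivalence oeq.
Proof.
  split.
  - intros a; split; reflexivity.
  - intros a b [H1 H2]; split; assumption.
  - intros a b c [H1 H2] [H3 H4]; split; etransitivity; eassumption.
Qed.

Instance ole_oeq : Proper (oeq ==> oeq ==> iff) ole.
Proof.
  intros a a' [A A'] b b' [B B']; split; intros H.
  - etransitivity; [exact A' |]; etransitivity; eassumption.
  - etransitivity; [exact A |]; etransitivity; eassumption.
Qed.

Instance olt_oeq : Proper (oeq ==> oeq ==> iff) olt.
Proof.
  intros a a' [A A'] b b' [B B']; split; intros H.
  - eapply ole_olt_trans; [exact A' |]; eapply olt_ole_trans; eassumption.
  - eapply ole_olt_trans; [exact A |]; eapply olt_ole_trans; eassumption.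
Qed.

Instance olt_ole_proper : Proper (ole --> ole ++> Basics.impl) olt.
Proof.
  intros a a' A b b' B H.
  eapply ole_olt_trans; [exact A |]; eapply olt_ole_trans; eassumption.
Qed.

Lemma olt_osucc a b : a < osucc b <-> a <= b.
Proof. split; [intros [_ H]; exact H | intros H; exists tt; exact H]. Qed.

Lemma osucc_ole a b : osucc a <= b <-> a < b.
Proof.
  destruct b as [V g]; split; [intros H; exact (H tt) | intros H u; exact H].
Qed.

Lemma ozero_ole a : ozero <= a.
Proof. destruct a as [U f]; intros []. Qed.

Lemma not_olt_ozero a : ~ a < ozero.
Proof. intros [[] _]. Qed.

Lemma olt_oone a : a < oone <-> a == ozero.
Proof.
  unfold oone; rewrite olt_osucc; split.
  - intros H; split; [exact H | apply ozero_ole].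
  - intros [H _]; exact H.
Qed.

Lemma ozero_or_pos a : a == ozero \/ ozero < a.
Proof.
  destruct (ole_or_olt a ozero) as [H | H]; [left | tauto].
  split; [exact H | apply ozero_ole].
Qed.

Lemma olt_osup (U : Type) (f : U -> ord) x : x < osup U f <-> exists i, x < f i.
Proof.
  split.
  - intros [[i j] H]; exists i; cbn in H, j.
    destruct (f i) as [V g]; exists j; exact H.
  - intros [i H]; unfold osup; assert (exists j, x <= child (f i) j) as [j Hj].
    { destruct (f i) as [V g]; exact H. }
    exists (existT _ i j); exact Hj.
Qed.

(** * Addition *)

(** This comes before the characterization of [x < a + b] because the latter
    must replace an arbitrary [d < b] by a child of [b] above it. *)
Lemma oadd_mono_r a b c : b <= c -> a + b <= a + c.
Proof.
  revert c; induction b as [V g IH]; intros [W h] H; apply ole_intro; intros x.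
  cbn [oadd]; rewrite !olt_osup; intros [[j |] Hx]; [| exists None; exact Hx].
  destruct (H j) as [k Hk]; exists (Some k).
  rewrite olt_osucc in *; etransitivity; [exact Hx | apply IH, Hk].
Qed.

Lemma olt_oadd x a b : x < a + b <-> x < a \/ exists d, d < b /\ x <= a + d.
Proof.
  destruct b as [V g]; cbn [oadd]; rewrite olt_osup; split.
  - intros [[j |] H]; [right | left; exact H].
    rewrite olt_osucc in H; exists (g j); split; [apply child_olt | exact H].
  - intros [H | (d & [j Hj] & H)]; [exists None; exact H | exists (Some j)].
    rewrite olt_osucc; etransitivity; [exact H | apply oadd_mono_r, Hj].
Qed.

Lemma oadd_smono_r a b c : b < c -> a + b < a + c.
Proof. intros H; apply olt_oadd; right; exists b; split; [exact H | reflexivity]. Qed.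

Lemma ole_oadd_l a b : a <= a + b.
Proof. apply ole_intro; intros x H; apply olt_oadd; left; exact H. Qed.

Lemma oadd_mono_l a a' b : a <= a' -> a + b <= a' + b.
Proof.
  intros H; induction (olt_wf b) as [b _ IH]; apply ole_intro; intros x.
  rewrite !olt_oadd; intros [Hx | (d & Hd & Hx)].
  - left; eapply olt_ole_trans; eassumption.
  - right; exists d; split; [exact Hd | rewrite Hx; apply IH, Hd].
Qed.

Instance oadd_ole : Proper (ole ==> ole ==> ole) oadd.
Proof.
  intros a a' A b b' B; etransitivity; [apply oadd_mono_l, A | apply oadd_mono_r, B].
Qed.

Instance oadd_oeq : Proper (oeq ==> oeq ==> oeq) oadd.
Proof. intros a a' [A A'] b b' [B B']; split; apply oadd_ole; assumption. Qed.

Instance osucc_ole_proper : Proper (ole ==> ole) osucc.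
Proof. intros a a' A; apply osucc_ole, olt_osucc, A. Qed.

Instance osucc_oeq : Proper (oeq ==> oeq) osucc.
Proof. intros a a' [A A']; split; apply osucc_ole_proper; assumption. Qed.

Lemma oadd_ozero_r a : a + ozero == a.
Proof.
  split; [| apply ole_oadd_l]; apply ole_intro; intros x; rewrite olt_oadd.
  intros [H | (d & H & _)]; [exact H | destruct (not_olt_ozero _ H)].
Qed.

Lemma oadd_osucc_r a b : a + osucc b == osucc (a + b).
Proof.
  split.
  - apply ole_intro; intros x; rewrite olt_oadd, olt_osucc; intros [H | (d & Hd & H)].
    + apply olt_ole; eapply olt_ole_trans; [exact H | apply ole_oadd_l].
    + apply olt_osucc in Hd; rewrite H, Hd; reflexivity.
  - apply osucc_ole, oadd_smono_r, olt_osucc; reflexivity.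
Qed.

Lemma oadd_assoc a b c : a + b + c == a + (b + c).
Proof.
  induction (olt_wf c) as [c _ IH]; split; apply ole_intro; intros x.
  - rewrite (olt_oadd x (a + b)); intros [H | (d & Hd & H)].
    + eapply olt_ole_trans; [exact H | apply oadd_mono_r, ole_oadd_l].
    + rewrite IH in H by exact Hd; eapply ole_olt_trans; [exact H |].
      apply oadd_smono_r, oadd_smono_r, Hd.
  - rewrite (olt_oadd x a); intros [H | (d & Hd & H)].
    + apply olt_oadd; left; apply olt_oadd; left; exact H.
    + apply olt_oadd in Hd; destruct Hd as [Hd | (e & He & Hd)].
      * apply olt_oadd; left; apply olt_oadd; right; exists d; tauto.
      * apply olt_oadd; right; exists e; split; [exact He |].
        rewrite IH by exact He; rewrite H, Hd; reflexivity.
Qed.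

Lemma ole_oadd_r a b : b <= a + b.
Proof.
  induction (olt_wf b) as [b _ IH]; apply ole_intro; intros x Hx.
  eapply ole_olt_trans; [apply (IH x Hx) | apply oadd_smono_r, Hx].
Qed.

Lemma oadd_ozero_l a : ozero + a == a.
Proof.
  split; [| apply ole_oadd_r].
  induction (olt_wf a) as [a _ IH]; apply ole_intro; intros x; rewrite olt_oadd.
  intros [H | (d & Hd & H)]; [destruct (not_olt_ozero _ H) |].
  eapply ole_olt_trans; [exact H |]; eapply ole_olt_trans; [apply IH |]; exact Hd.
Qed.

Lemma oadd_cancel_olt a b c : a + b < a + c -> b < c.
Proof.
  intros H; destruct (ole_or_olt c b) as [Hle | Hlt]; [| exact Hlt].
  destruct (ole_not_olt (a + c) (a + b)); [apply oadd_mono_r, Hle | exact H].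
Qed.

Lemma oadd_cancel a b c : a + b == a + c -> b == c.
Proof.
  intros [H1 H2]; split.
  - destruct (ole_or_olt b c) as [H | H]; [exact H |].
    destruct (ole_not_olt _ _ H1); apply oadd_smono_r, H.
  - destruct (ole_or_olt c b) as [H | H]; [exact H |].
    destruct (ole_not_olt _ _ H2); apply oadd_smono_r, H.
Qed.

(** The difference is the least [r] with [b <= a + r]: by minimality, all
    [a + d] with [d < r] lie below [b]. *)
Lemma osub_exists a b : a <= b -> exists r, b == a + r.
Proof.
  intros H.
  destruct (ord_least (fun r => b <= a + r)) as (r & Hr & Hmin).
  { exists b; apply ole_oadd_r. }
  exists r; split; [exact Hr |]; apply ole_intro; intros x; rewrite olt_oadd.
  intros [Hx | (d & Hd & Hx)]; [eapply olt_ole_trans; eassumption |].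
  eapply ole_olt_trans; [exact Hx |].
  destruct (ole_or_olt b (a + d)) as [N | N]; [| exact N].
  destruct (Hmin d Hd N).
Qed.

Lemma oadd_oone_l_ole a : oone + a <= osucc a.
Proof.
  induction (olt_wf a) as [a _ IH]; apply ole_intro; intros x.
  rewrite olt_oadd, olt_osucc; intros [H | (d & Hd & H)].
  - apply olt_oone in H; rewrite H; apply ozero_ole.
  - rewrite H, (IH d Hd); apply osucc_ole, Hd.
Qed.

(** * Multiplication and division *)

Lemma omul_mono_r a b c : b <= c -> a * b <= a * c.
Proof.
  revert c; induction b as [V g IH]; intros [W h] H; apply ole_intro; intros x.
  cbn [omul]; rewrite !olt_osup; intros [j Hx].
  destruct (H j) as [k Hk]; exists k.
  eapply olt_ole_trans; [exact Hx | apply oadd_mono_l, IH, Hk].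
Qed.

Lemma olt_omul x a b : x < a * b <-> exists d, d < b /\ x < a * d + a.
Proof.
  destruct b as [V g]; cbn [omul]; rewrite olt_osup; split.
  - intros [j H]; exists (g j); split; [apply child_olt | exact H].
  - intros (d & [j Hj] & H); exists j.
    eapply olt_ole_trans; [exact H | apply oadd_mono_l, omul_mono_r, Hj].
Qed.

Lemma omul_mono_l a a' b : a <= a' -> a * b <= a' * b.
Proof.
  intros H; induction (olt_wf b) as [b _ IH]; apply ole_intro; intros x.
  rewrite !olt_omul; intros (d & Hd & Hx); exists d; split; [exact Hd |].
  eapply olt_ole_trans; [exact Hx | apply oadd_ole; [apply IH, Hd | exact H]].
Qed.

Instance omul_ole : Proper (ole ==> ole ==> ole) omul.
Proof.
  intros a a' A b b' B; etransitivity; [apply omul_mono_l, A | apply omul_mono_r, B].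
Qed.

Instance omul_oeq : Proper (oeq ==> oeq ==> oeq) omul.
Proof. intros a a' [A A'] b b' [B B']; split; apply omul_ole; assumption. Qed.

Lemma omul_ozero_r a : a * ozero == ozero.
Proof.
  split; [| apply ozero_ole]; apply ole_intro; intros x; rewrite olt_omul.
  intros (d & H & _); destruct (not_olt_ozero _ H).
Qed.

Lemma omul_osucc_r a b : a * osucc b == a * b + a.
Proof.
  split; apply ole_intro; intros x; rewrite olt_omul.
  - intros (d & Hd & H); apply olt_osucc in Hd.
    eapply olt_ole_trans; [exact H | apply oadd_mono_l, omul_mono_r, Hd].
  - intros H; exists b; split; [apply olt_osucc; reflexivity | exact H].
Qed.

Lemma omul_oone_r a : a * oone == a.
Proof. unfold oone; rewrite omul_osucc_r, omul_ozero_r, oadd_ozero_l; reflexivity. Qed.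

Lemma omul_ozero_l a : ozero * a == ozero.
Proof.
  split; [| apply ozero_ole]; induction (olt_wf a) as [a _ IH].
  apply ole_intro; intros x; rewrite olt_omul; intros (d & Hd & H).
  rewrite (IH d Hd), oadd_ozero_r in H; exact H.
Qed.

Lemma omul_oone_l a : oone * a == a.
Proof.
  induction (olt_wf a) as [a _ IH]; split; apply ole_intro; intros x.
  - rewrite olt_omul; intros (d & Hd & H).
    rewrite (IH d Hd) in H; unfold oone in H.
    rewrite oadd_osucc_r, oadd_ozero_r in H.
    eapply olt_ole_trans; [exact H | apply osucc_ole, Hd].
  - intros H; apply olt_omul; exists x; split; [exact H |].
    rewrite (IH x H); unfold oone; rewrite oadd_osucc_r, oadd_ozero_r.
    apply olt_osucc; reflexivity.
Qed.

Lemma omul_osucc_ole a b c : b < c -> a * b + a <= a * c.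
Proof. intros H; rewrite <- omul_osucc_r; apply omul_mono_r, osucc_ole, H. Qed.

Lemma omul_smono_r a b c : ozero < a -> b < c -> a * b < a * c.
Proof.
  intros Ha H; eapply olt_ole_trans; [| apply omul_osucc_ole, H].
  rewrite <- oadd_ozero_r at 1; apply oadd_smono_r, Ha.
Qed.

Lemma omul_oadd_r a b c : a * (b + c) == a * b + a * c.
Proof.
  induction (olt_wf c) as [c _ IH]; split; apply ole_intro; intros x.
  - rewrite olt_omul; intros (d & Hd & H).
    apply olt_oadd in Hd; destruct Hd as [Hd | (e & He & Hd)].
    + eapply olt_ole_trans; [exact H |].
      etransitivity; [apply omul_osucc_ole, Hd | apply ole_oadd_l].
    + eapply olt_ole_trans; [exact H |].
      rewrite Hd, (IH e He), oadd_assoc; apply oadd_mono_r, omul_osucc_ole, He.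
  - rewrite olt_oadd; intros [H | (d & Hd & H)].
    + eapply olt_ole_trans; [exact H | apply omul_mono_r, ole_oadd_l].
    + apply olt_omul in Hd; destruct Hd as (e & He & Hd).
      apply olt_omul; exists (b + e); split; [apply oadd_smono_r, He |].
      rewrite (IH e He), oadd_assoc.
      eapply ole_olt_trans; [exact H | apply oadd_smono_r, Hd].
Qed.

Lemma omul_assoc a b c : a * b * c == a * (b * c).
Proof.
  induction (olt_wf c) as [c _ IH]; split; apply ole_intro; intros x.
  - rewrite (olt_omul x (a * b)); intros (d & Hd & H).
    rewrite (IH d Hd), <- omul_oadd_r in H.
    eapply olt_ole_trans; [exact H | apply omul_mono_r, omul_osucc_ole, Hd].
  - rewrite (olt_omul x a); intros (d & Hd & H).
    apply olt_omul in Hd; destruct Hd as (e & He & Hd).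
    apply olt_omul; exists e; split; [exact He |].
    rewrite (IH e He), <- omul_oadd_r.
    eapply olt_ole_trans; [exact H | apply omul_osucc_ole, Hd].
Qed.

Lemma ole_omul_pos a b : ozero < a -> b <= a * b.
Proof.
  intros Ha; rewrite <- (omul_oone_l b) at 1; apply omul_mono_l, osucc_ole, Ha.
Qed.

(** The quotient is the least [q] with [x < a * (q + 1)]; by minimality
    [a * q <= x], and the remainder is the difference. *)
Lemma odiv_exists a x : ozero < a -> exists q r, x == a * q + r /\ r < a.
Proof.
  intros Ha.
  destruct (ord_least (fun q => x < a * q + a)) as (q & Hq & Hmin).
  { exists x; eapply ole_olt_trans; [apply (ole_omul_pos a x Ha) |].
    rewrite <- oadd_ozero_r at 1; apply oadd_smono_r, Ha. }
  destruct (osub_exists (a * q) x) as [r Hr].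
  { destruct (ole_or_olt (a * q) x) as [H | H]; [exact H |].
    apply olt_omul in H; destruct H as (d & Hd & H); destruct (Hmin d Hd H). }
  exists q, r; split; [exact Hr |].
  rewrite Hr in Hq; exact (oadd_cancel_olt _ _ _ Hq).
Qed.

Lemma odiv_olt_quot a q r q' : r < a -> a * q + r < a * q' -> q < q'.
Proof.
  intros Hr H; destruct (ole_or_olt q' q) as [N | N]; [| exact N].
  destruct (ole_not_olt (a * q') (a * q + r)); [| exact H].
  rewrite N; apply ole_oadd_l.
Qed.

Lemma odiv_olt_of_quot a q r q' : r < a -> q < q' -> a * q + r < a * q'.
Proof.
  intros Hr H; eapply olt_ole_trans; [apply oadd_smono_r, Hr | apply omul_osucc_ole, H].
Qed.

Lemma odiv_ole_quot a q r q' r' :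
  r' < a -> a * q + r <= a * q' + r' -> q <= q'.
Proof.
  intros Hr H; destruct (ole_or_olt q q') as [N | N]; [exact N |].
  destruct (ole_not_olt _ _ H).
  eapply olt_ole_trans; [apply odiv_olt_of_quot; eassumption | apply ole_oadd_l].
Qed.

Lemma odiv_unique a q r q' r' :
  r < a -> r' < a -> a * q + r == a * q' + r' -> q == q' /\ r == r'.
Proof.
  intros Hr Hr' H; assert (q == q') as E.
  { split; eapply odiv_ole_quot; [exact Hr' | apply H | exact Hr | apply H]. }
  split; [exact E |]; rewrite E in H; exact (oadd_cancel _ _ _ H).
Qed.

Definition odvd (a b : ord) : Prop := exists q, b == a * q.

Instance odvd_oeq : Proper (oeq ==> oeq ==> iff) odvd.
Proof.
  intros a a' A b b' B; split; intros [q H]; exists q.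
  - rewrite <- A, <- B; exact H.
  - rewrite A, B; exact H.
Qed.

Lemma odvd_trans a b c : odvd a b -> odvd b c -> odvd a c.
Proof.
  intros [p Hp] [q Hq]; exists (p * q); rewrite Hq, Hp; apply omul_assoc.
Qed.

Lemma odvd_olt_ozero a b : odvd a b -> b < a -> b == ozero.
Proof.
  intros [q Hq] H; destruct (ozero_or_pos q) as [E | E].
  - rewrite Hq, E; apply omul_ozero_r.
  - destruct (olt_irrefl b); eapply olt_ole_trans; [exact H |].
    rewrite Hq, <- omul_oone_r at 1; apply omul_mono_r, osucc_ole, E.
Qed.

(** Multiples of [a] are closed under left subtraction, by uniqueness of the
    remainder of [b + c]. *)
Lemma odvd_oadd_cancel a b c : ozero < a -> odvd a b -> odvd a (b + c) -> odvd a c.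
Proof.
  intros Ha [p Hp] [s Hs].
  destruct (odiv_exists a c Ha) as (q & r & Hc & Hr).
  rewrite Hp, Hc, <- oadd_assoc, <- omul_oadd_r in Hs.
  destruct (odiv_unique a (p + q) r s ozero Hr Ha) as [_ E].
  { rewrite Hs, oadd_ozero_r; reflexivity. }
  exists q; rewrite Hc, E; apply oadd_ozero_r.
Qed.

(** * Powers of omega *)

Lemma omega_pow_mono a b : a <= b -> omega_pow a <= omega_pow b.
Proof.
  revert b; induction a as [V g IH]; intros [W h] H; apply ole_intro; intros x.
  cbn [omega_pow]; rewrite !olt_osup; intros [[j |] Hx]; [| exists None; exact Hx].
  destruct (H j) as [k Hk]; exists (Some k).
  eapply olt_ole_trans; [exact Hx | apply omul_mono_l, IH, Hk].
Qed.

Instance omega_pow_ole : Proper (ole ==> ole) omega_pow.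
Proof. intros a b; apply omega_pow_mono. Qed.

Instance omega_pow_oeq : Proper (oeq ==> oeq) omega_pow.
Proof. intros a a' [A A']; split; apply omega_pow_mono; assumption. Qed.

Lemma olt_omega_pow x b :
  x < omega_pow b <-> x < oone \/ exists d, d < b /\ x < omega_pow d * omega.
Proof.
  destruct b as [V g]; cbn [omega_pow]; rewrite olt_osup; split.
  - intros [[j |] H]; [right | left; exact H].
    exists (g j); split; [apply child_olt | exact H].
  - intros [H | (d & [j Hj] & H)]; [exists None; exact H | exists (Some j)].
    eapply olt_ole_trans; [exact H | apply omul_mono_l, omega_pow_mono, Hj].
Qed.

Lemma omega_pow_pos a : ozero < omega_pow a.
Proof. apply olt_omega_pow; left; apply olt_oone; reflexivity. Qed.

Lemma omega_pow_ozero : omega_pow ozero == oone.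
Proof.
  split; [| apply osucc_ole, omega_pow_pos].
  apply ole_intro; intros x; rewrite olt_omega_pow.
  intros [H | (d & H & _)]; [exact H | destruct (not_olt_ozero _ H)].
Qed.

Lemma onat_olt_omega k : onat k < omega.
Proof. apply (child_olt nat onat). Qed.

Lemma olt_omega_osucc x : x < omega -> osucc x < omega.
Proof. intros [k H]; exists (S k); apply osucc_ole_proper, H. Qed.

Lemma omega_pow_osucc b : omega_pow (osucc b) == omega_pow b * omega.
Proof.
  split; apply ole_intro; intros x; rewrite olt_omega_pow.
  - intros [H | (d & Hd & H)].
    + apply olt_oone in H; rewrite H, <- (omul_ozero_r (omega_pow b)).
      apply omul_smono_r; [apply omega_pow_pos | apply (onat_olt_omega 0)].
    + apply olt_osucc in Hd.
      eapply olt_ole_trans; [exact H | apply omul_mono_l, omega_pow_mono, Hd].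
  - intros H; right; exists b; split; [apply olt_osucc; reflexivity | exact H].
Qed.

Lemma omega_pow_oadd b c : omega_pow (b + c) == omega_pow b * omega_pow c.
Proof.
  induction (olt_wf c) as [c _ IH]; split; apply ole_intro; intros x.
  - rewrite olt_omega_pow; intros [H | (d & Hd & H)].
    + eapply olt_ole_trans; [exact H |]; apply osucc_ole.
      rewrite <- (omul_ozero_r (omega_pow b)).
      apply omul_smono_r; apply omega_pow_pos.
    + apply olt_oadd in Hd; destruct Hd as [Hd | (e & He & Hd)].
      * eapply olt_ole_trans; [exact H |].
        rewrite <- omega_pow_osucc.
        transitivity (omega_pow b); [apply omega_pow_mono, osucc_ole, Hd |].
        rewrite <- (omul_oone_r (omega_pow b)) at 1.
        apply omul_mono_r, osucc_ole, omega_pow_pos.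
      * eapply olt_ole_trans; [exact H |].
        rewrite Hd, (IH e He), omul_assoc, <- omega_pow_osucc.
        apply omul_mono_r, omega_pow_mono, osucc_ole, He.
  - rewrite olt_omul; intros (d & Hd & H).
    apply olt_omega_pow in Hd; destruct Hd as [Hd | (e & He & Hd)].
    + apply olt_oone in Hd; rewrite Hd, omul_ozero_r, oadd_ozero_l in H.
      eapply olt_ole_trans; [exact H | apply omega_pow_mono, ole_oadd_l].
    + apply olt_omega_pow; right; exists (b + e); split; [apply oadd_smono_r, He |].
      rewrite (IH e He), omul_assoc.
      eapply olt_ole_trans; [exact H | apply omul_osucc_ole, Hd].
Qed.

Lemma omega_pow_odvd b c : b <= c -> odvd (omega_pow b) (omega_pow c).
Proof.
  intros H; destruct (osub_exists b c H) as [r Hr].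
  exists (omega_pow r); rewrite Hr; apply omega_pow_oadd.
Qed.

(** [a * omega] is a limit ordinal. *)
Lemma osucc_olt_omul_omega a x : ozero < a -> x < a * omega -> osucc x < a * omega.
Proof.
  intros Ha; rewrite !olt_omul; intros (d & Hd & H).
  exists (osucc d); split; [apply olt_omega_osucc, Hd |].
  apply osucc_ole in H; eapply ole_olt_trans; [exact H |].
  rewrite <- (omul_osucc_r a d), <- (oadd_ozero_r (a * osucc d)) at 1; apply oadd_smono_r, Ha.
Qed.

Lemma olt_omul_omega a x : x < a * omega -> exists k, x < a * onat k.
Proof.
  rewrite olt_omul; intros (d & [k Hk] & H); exists (S k); cbn [onat].
  rewrite omul_osucc_r, <- Hk; exact H.
Qed.

(** A finite multiple of [a] may be extended on either side, although [+] does
    not commute. *)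
Lemma oadd_omul_onat a k : a + a * onat k == a * onat (S k).
Proof.
  induction k as [| k IH]; cbn [onat] in *.
  - rewrite omul_osucc_r, omul_ozero_r, oadd_ozero_r, oadd_ozero_l; reflexivity.
  - transitivity (a + a * onat k + a).
    + rewrite omul_osucc_r, oadd_assoc; reflexivity.
    + rewrite IH, <- omul_osucc_r; reflexivity.
Qed.

Lemma oone_oadd_onat k : oone + onat k == onat (S k).
Proof.
  rewrite <- (omul_oone_l (onat k)), oadd_omul_onat, omul_oone_l; reflexivity.
Qed.

Lemma olt_oone_oadd_finite z : z < omega -> z < oone + z.
Proof.
  intros [k Hk]; destruct (ole_or_olt (oone + z) z) as [N | N]; [| exact N].
  destruct (osub_exists z (onat k) Hk) as [r Hr].
  destruct (olt_irrefl (onat k)).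
  apply osucc_ole; change (osucc (onat k)) with (onat (S k)).
  rewrite <- oone_oadd_onat, Hr, <- oadd_assoc, N; reflexivity.
Qed.

Lemma omega_pow_oone : omega_pow oone == omega.
Proof. unfold oone; rewrite omega_pow_osucc, omega_pow_ozero; apply omul_oone_l. Qed.

Lemma oone_oadd_omega : oone + omega <= omega.
Proof.
  apply ole_intro; intros x; rewrite olt_oadd; intros [H | (d & [k Hk] & H)].
  - eapply olt_ole_trans; [exact H | apply osucc_ole, (onat_olt_omega 0)].
  - eapply ole_olt_trans; [exact H |].
    rewrite Hk, oone_oadd_onat; apply onat_olt_omega.
Qed.

Lemma oone_oadd_infinite a : omega <= a -> oone + a == a.
Proof.
  intros H; split; [| apply ole_oadd_r]; destruct (osub_exists _ _ H) as [r Hr].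
  rewrite Hr, <- oadd_assoc, oone_oadd_omega; reflexivity.
Qed.

(** * Order types of sets of words *)

(** [expo a] is the exponent with [words a = omega^(expo a)], written as the
    recursion [expo a = sup {expo d * k + 1 : d < a, k}], that is,
    [words (d+1) = sup {(words d)^k * omega : k}].  The factor [omega] does not
    change the supremum of the powers of [words d] when that is infinite, and
    gives [omega] when [words d = 1].  In closed form [expo 0 = 0] and
    [expo (1 + b) = omega^b]. *)
Fixpoint expo (a : ord) : ord :=
  match a with
  | lsup J g => osup (J * nat) (fun p => osucc (expo (g (fst p)) * onat (snd p)))
  end.

Lemma expo_mono a b : a <= b -> expo a <= expo b.
Proof.
  revert b; induction a as [V g IH]; intros [W h] H; apply ole_intro; intros x.
  cbn [expo]; rewrite !olt_osup; intros [[j k] Hx].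
  destruct (H j) as [j' Hj]; exists (j', k); cbn [fst snd] in *.
  eapply olt_ole_trans; [exact Hx |].
  apply osucc_ole_proper, omul_mono_l, IH, Hj.
Qed.

Instance expo_oeq : Proper (oeq ==> oeq) expo.
Proof. intros a a' [A A']; split; apply expo_mono; assumption. Qed.

Lemma olt_expo x a : x < expo a <-> exists d k, d < a /\ x <= expo d * onat k.
Proof.
  destruct a as [V g]; cbn [expo]; rewrite olt_osup; split.
  - intros [[j k] H]; apply olt_osucc in H; exists (g j), k.
    split; [apply child_olt | exact H].
  - intros (d & k & [j Hj] & H); exists (j, k); apply olt_osucc; cbn [fst snd].
    rewrite H; apply omul_mono_l, expo_mono, Hj.
Qed.

Lemma expo_le_omega_pow a : expo a <= omega_pow a.
Proof.
  induction (olt_wf a) as [a _ IH]; apply ole_intro; intros x.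
  rewrite olt_expo; intros (d & k & Hd & H).
  apply olt_omega_pow; right; exists d; split; [exact Hd |].
  eapply ole_olt_trans; [exact H |]; rewrite (IH d Hd).
  apply omul_smono_r; [apply omega_pow_pos | apply onat_olt_omega].
Qed.

(** The shift by [1 +] is needed because [expo 0 = 0] while [omega^0 = 1]; it
    disappears for infinite arguments. *)
Lemma omega_pow_le_expo b : omega_pow b <= expo (oone + b).
Proof.
  induction (olt_wf b) as [b _ IH]; apply ole_intro; intros x.
  rewrite olt_omega_pow; intros [H | (d & Hd & H)].
  - apply olt_oone in H; rewrite H; apply olt_expo; exists ozero, 0.
    split; [| apply ozero_ole].
    eapply olt_ole_trans; [| apply ole_oadd_l]; apply olt_oone; reflexivity.
  - destruct (olt_omul_omega _ _ H) as [k Hk].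
    apply olt_expo; exists (oone + d), k; split; [apply oadd_smono_r, Hd |].
    rewrite <- (IH d Hd); apply olt_ole, Hk.
Qed.

(** The order type of the finite words over an alphabet of type [a]; equally,
    the rank of the one-letter word whose letter has rank [a]. *)
Definition words (a : ord) : ord := omega_pow (expo a).

Lemma words_infinite a : omega <= a -> words a == omega_pow (omega_pow a).
Proof.
  intros H; unfold words; split; apply omega_pow_mono.
  - apply expo_le_omega_pow.
  - rewrite omega_pow_le_expo; apply expo_mono, oone_oadd_infinite, H.
Qed.

Lemma words_oone : words oone == omega.
Proof.
  rewrite <- omega_pow_oone; split; apply omega_pow_mono.
  - apply ole_intro; intros x; rewrite olt_expo; intros (d & k & Hd & H).
    apply olt_oone in Hd; apply olt_oone; split; [| apply ozero_ole].
    assert (expo ozero == ozero) as E.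
    { split; [| apply ozero_ole]; apply ole_intro; intros y; rewrite olt_expo.
      intros (e & _ & He & _); destruct (not_olt_ozero _ He). }
    rewrite H, Hd, E; apply omul_ozero_l.
  - transitivity (expo (oone + ozero)); [| rewrite oadd_ozero_r; reflexivity].
    rewrite <- omega_pow_le_expo, omega_pow_ozero; reflexivity.
Qed.

Instance words_oeq : Proper (oeq ==> oeq) words.
Proof. intros a a' A; unfold words; rewrite A; reflexivity. Qed.

Lemma words_pos a : ozero < words a.
Proof. apply omega_pow_pos. Qed.

Lemma words_odvd a b : a <= b -> odvd (words a) (words b).
Proof. intros H; apply omega_pow_odvd, expo_mono, H. Qed.

(** Continuity of [words] at limits: a word uses only finitely many letters,
    hence only letters up to some [d]. *)
Lemma olt_words x a :
  ozero < x -> x < words a -> exists d, d < a /\ x < words (osucc d).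
Proof.
  intros Hpos H; apply olt_omega_pow in H; destruct H as [H | (e & He & H)].
  - apply olt_oone in H; rewrite H in Hpos; destruct (olt_irrefl _ Hpos).
  - apply olt_expo in He; destruct He as (d & k & Hd & He).
    exists d; split; [exact Hd |].
    eapply olt_ole_trans; [exact H |]; rewrite <- omega_pow_osucc.
    apply omega_pow_mono, osucc_ole, olt_expo; exists d, k.
    split; [apply olt_osucc; reflexivity | exact He].
Qed.

Lemma olt_words_osucc x c :
  x < words (osucc c) <-> exists k, x < omega_pow (expo c * onat k) * omega.
Proof.
  split.
  - intros H; apply olt_omega_pow in H; destruct H as [H | (e & He & H)].
    + exists 0; apply olt_oone in H; rewrite H, <- omega_pow_osucc.
      apply omega_pow_pos.
    + apply olt_expo in He; destruct He as (d & k & Hd & He); exists k.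
      apply olt_osucc in Hd; eapply olt_ole_trans; [exact H |].
      apply omul_mono_l, omega_pow_mono; rewrite He.
      apply omul_mono_l, expo_mono, Hd.
  - intros [k H]; eapply olt_ole_trans; [exact H |]; rewrite <- omega_pow_osucc.
    apply omega_pow_mono, osucc_ole, olt_expo; exists c, k.
    split; [apply olt_osucc; reflexivity | reflexivity].
Qed.

Lemma words_omul_power c k :
  words c * (omega_pow (expo c * onat k) * omega)
  == omega_pow (expo c * onat (S k)) * omega.
Proof.
  unfold words; rewrite <- omul_assoc, <- omega_pow_oadd, oadd_omul_onat.
  reflexivity.
Qed.

(** If [z] lies below a power [(words c)^k * omega], multiplying by [words c]
    leads to the next power, and all these powers are below [words (c+1)]. *)
Lemma words_step_olt c z :
  z < words (osucc c) -> words c * (oone + z) < words (osucc c).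
Proof.
  rewrite !olt_words_osucc; intros [k H]; exists (S k).
  rewrite <- words_omul_power; apply omul_smono_r; [apply words_pos |].
  eapply ole_olt_trans; [apply oadd_oone_l_ole |].
  apply osucc_olt_omul_omega; [apply omega_pow_pos | exact H].
Qed.

(** The powers [(words c)^k * omega] leave no fixed point: multiplication by
    [words c] carries [z] past the first power above it.  Below [omega] it
    is the summand [1] that makes the difference, as when [words c = 1]. *)
Lemma words_step_ogt c z : z < words (osucc c) -> z < words c * (oone + z).
Proof.
  rewrite olt_words_osucc; intros [k H]; induction k as [| k IH].
  - eapply olt_ole_trans; [| apply ole_omul_pos, words_pos].
    apply olt_oone_oadd_finite.
    cbn [onat] in H; rewrite omul_ozero_r, omega_pow_ozero, omul_oone_l in H.
    exact H.
  - destruct (ole_or_olt (omega_pow (expo c * onat k) * omega) z) as [N | N];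
      [| exact (IH N)].
    eapply olt_ole_trans; [exact H |]; rewrite <- words_omul_power.
    apply omul_mono_r; rewrite N; apply ole_oadd_r.
Qed.

(** * Prefixing a letter *)

(** [prefix c x b]: if a word has rank [x], then [b] is the rank of this word
    preceded by a letter of rank [c].  The [1 +] makes room for the words
    without that letter: when [x = 0], the rank [b] is [words c], the type of
    the set of words over the smaller letters. *)
Definition prefix (c x b : ord) : Prop :=
  exists q z, x == words (osucc c) * q + z /\ z < words (osucc c) /\
    b == words (osucc c) * q + words c * (oone + z).

Instance prefix_oeq : Proper (oeq ==> oeq ==> oeq ==> iff) prefix.
Proof.
  assert (forall c c' x x' b b', c == c' -> x == x' -> b == b' ->
    prefix c x b -> prefix c' x' b') as W.
  { intros c c' x x' b b' C X B (q & z & Hx & Hz & Hb); exists q, z.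
    rewrite <- X, <- B, <- C; tauto. }
  intros c c' C x x' X b b' B; split; apply W; auto; symmetry; auto.
Qed.

Lemma prefix_exists c x : exists b, prefix c x b.
Proof.
  destruct (odiv_exists _ x (words_pos (osucc c))) as (q & z & Hx & Hz).
  exists (words (osucc c) * q + words c * (oone + z)), q, z.
  split; [exact Hx | split; [exact Hz | reflexivity]].
Qed.

Lemma prefix_unique c x b b' : prefix c x b -> prefix c x b' -> b == b'.
Proof.
  intros (q & z & Hx & Hz & Hb) (q' & z' & Hx' & Hz' & Hb').
  rewrite Hx in Hx'; destruct (odiv_unique _ _ _ _ _ Hz Hz' Hx') as [Q Z].
  rewrite Hb, Hb', Q, Z; reflexivity.
Qed.

Lemma prefix_ogt c x b : prefix c x b -> x < b.
Proof.
  intros (q & z & Hx & Hz & Hb); rewrite Hx, Hb.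
  apply oadd_smono_r, words_step_ogt, Hz.
Qed.

(** The ranks of words beginning with a letter above [c] are multiples of
    [words (c+1)] ([prefix_odvd]), so this is clause (a) of the order. *)
Lemma prefix_olt_multiple c x b m :
  prefix c x b -> odvd (words (osucc c)) m -> x < m -> b < m.
Proof.
  intros (q & z & Hx & Hz & Hb) [p Hp]; rewrite Hx, Hb, Hp; intros H.
  apply odiv_olt_of_quot; [apply words_step_olt, Hz |].
  exact (odiv_olt_quot _ _ _ _ Hz H).
Qed.

Lemma prefix_smono c x x' b b' :
  prefix c x b -> prefix c x' b' -> x < x' -> b < b'.
Proof.
  intros (q & z & Hx & Hz & Hb) (q' & z' & Hx' & Hz' & Hb') H.
  rewrite Hx, Hx' in H; rewrite Hb, Hb'.
  pose proof (odiv_ole_quot _ _ _ _ _ Hz' (olt_ole _ _ H)) as Hq.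
  destruct (ole_or_olt q' q) as [Hq' | Hlt].
  - assert (q == q') as E by (split; assumption); rewrite E in H |- *.
    apply oadd_smono_r, omul_smono_r; [apply words_pos |].
    exact (oadd_smono_r _ _ _ (oadd_cancel_olt _ _ _ H)).
  - eapply olt_ole_trans; [| apply ole_oadd_l].
    apply odiv_olt_of_quot; [apply words_step_olt, Hz | exact Hlt].
Qed.

(** Since [words c] divides [words (c+1)], both summands are multiples. *)
Lemma prefix_odvd c x b : prefix c x b -> odvd (words c) b.
Proof.
  intros (q & z & _ & _ & Hb).
  destruct (words_odvd c (osucc c)) as [p Hp].
  { apply olt_ole, olt_osucc; reflexivity. }
  exists (p * q + (oone + z)); rewrite Hb, (omul_oadd_r _ (p * q)), <- omul_assoc, <- Hp.
  reflexivity.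
Qed.

(** The rank of a word determines its first letter: [c] is the least ordinal
    such that [words (c+1)] does not divide [b].  Then [words c] divides [b],
    by continuity of [words] when [c] is a limit, so the remainder of [b]
    modulo [words (c+1)] is a nonzero multiple of [words c], that is, of the
    form [words c * (1 + z)]. *)
Lemma prefix_surjective a b :
  ozero < b -> b < words a -> exists c x, c < a /\ x < b /\ prefix c x b.
Proof.
  intros Hpos Hb.
  destruct (ord_least (fun c => ~ odvd (words (osucc c)) b)) as (c & Hc & Hmin).
  { destruct (olt_words b a Hpos Hb) as (d & _ & Hd); exists d; intros N.
    apply (odvd_olt_ozero _ _ N) in Hd; rewrite Hd in Hpos.
    exact (olt_irrefl _ Hpos). }
  assert (c < a) as Hca.
  { destruct (olt_words b a Hpos Hb) as (d & Hda & Hd).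
    eapply ole_olt_trans; [| exact Hda].
    destruct (ole_or_olt c d) as [N | N]; [exact N |].
    apply Hmin, NNPP in N; apply (odvd_olt_ozero _ _ N) in Hd; rewrite Hd in Hpos.
    destruct (olt_irrefl _ Hpos). }
  (* A nonzero remainder modulo [words c] would be below some [words (d+1)]
     with [d < c], which divides it by minimality of [c]. *)
  assert (odvd (words c) b) as Hdvd.
  { destruct (odiv_exists _ b (words_pos c)) as (q & r & Hq & Hr).
    destruct (ozero_or_pos r) as [Z | Z].
    - exists q; rewrite Hq, Z; apply oadd_ozero_r.
    - destruct (olt_words r c Z Hr) as (d & Hd & Hrd).
      pose proof (NNPP _ (Hmin d Hd)) as Hdb; rewrite Hq in Hdb.
      apply odvd_oadd_cancel in Hdb; [| apply words_pos |].
      + apply (odvd_olt_ozero _ _ Hdb) in Hrd; rewrite Hrd in Z.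
        destruct (olt_irrefl _ Z).
      + eapply odvd_trans; [apply words_odvd, osucc_ole, Hd |].
        exists q; reflexivity. }
  destruct (odiv_exists _ b (words_pos (osucc c))) as (q & r & Hq & Hr).
  assert (odvd (words c) r) as [s Hs].
  { rewrite Hq in Hdvd; eapply odvd_oadd_cancel; [apply words_pos | | exact Hdvd].
    eapply odvd_trans; [apply words_odvd, olt_ole, olt_osucc; reflexivity |].
    exists q; reflexivity. }
  destruct (ozero_or_pos s) as [Z | Z].
  { destruct Hc; exists q; rewrite Hq, Hs, Z, omul_ozero_r; apply oadd_ozero_r. }
  destruct (osub_exists oone s) as [z Hz]; [apply osucc_ole, Z |].
  assert (z < words (osucc c)) as Hzlt.
  { eapply ole_olt_trans; [| exact Hr]; rewrite Hs.
    etransitivity; [| apply ole_omul_pos, words_pos]; rewrite Hz; apply ole_oadd_r. }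
  assert (prefix c (words (osucc c) * q + z) b) as Hp.
  { exists q, z; split; [reflexivity |]; split; [exact Hzlt |].
    rewrite Hq, Hs, Hz; reflexivity. }
  exists c, (words (osucc c) * q + z); split; [exact Hca |].
  split; [exact (prefix_ogt _ _ _ Hp) | exact Hp].
Qed.

Definition prefix_fun (c x : ord) : ord :=
  proj1_sig (constructive_indefinite_description _ (prefix_exists c x)).

Lemma prefix_funP c x : prefix c x (prefix_fun c x).
Proof. exact (proj2_sig (constructive_indefinite_description _ _)). Qed.

(** * The levels of the notation system *)

Definition level (n i : nat) (t : term) : Prop :=
  OT n t /\ (Sub t <= Z.of_nat i)%Z /\ forall j, (j < i)%nat -> ~ occurs j t.

Lemma level_Zero n i : level n i Zero.
Proof.
  split; [constructor |]; split; [cbn; lia | intros j _ []].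
Qed.

(** [Sub] bounds the leading index from above and the forbidden symbols bound
    it from below, so it is [i]; and [theta_i] itself being forbidden in
    [alpha] is what puts [alpha] on the next level. *)
Lemma level_Theta n i j alpha beta : (i < n)%nat ->
  level n i (Theta j alpha beta) <->
  j = i /\ level n (S i) alpha /\ level n i beta.
Proof.
  intros Hi; split.
  - intros (HO & HS & Hocc); cbn in HS.
    assert (j = i) as ->.
    { destruct (Nat.lt_ge_cases j i) as [N | N]; [| lia].
      destruct (Hocc j N); cbn; tauto. }
    inversion HO as [| ? ? ? Hal Hbe _ Sal Sbe Hocc_al]; subst; split; [reflexivity | split; split; trivial; split].
    + lia.
    + intros k Hk; apply Hocc_al; lia.
    + exact Sbe.
    + intros k Hk N; apply (Hocc k Hk); cbn; tauto.
  - intros (-> & (HO & HS & Hocc) & (HO' & HS' & Hocc')).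
    split; [| split].
    + constructor; trivial; [lia |]; intros k Hk; apply Hocc; lia.
    + cbn; lia.
    + intros k Hk [E | [N | N]]; [lia | |].
      * apply (Hocc k); [lia | exact N].
      * exact (Hocc' k Hk N).
Qed.

Lemma level_top n t : level n n t -> t = Zero.
Proof.
  intros (HO & _ & Hocc); destruct HO as [| i alpha beta]; [reflexivity |].
  destruct (Hocc i); [assumption | cbn; tauto].
Qed.

Lemma OT0_level n t : OT0 n t <-> level n 0 t.
Proof.
  split; [intros [H1 H2] | intros (H1 & H2 & _); split; assumption].
  split; [exact H1 |]; split; [exact H2 | intros j Hj; lia].
Qed.

(** * The isomorphism between terms and ordinals *)

Lemma has_order_type_ext (A : Type) (P Q : A -> Prop) R a b :
  (forall x, P x <-> Q x) -> a == b ->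
  has_order_type A P R a -> has_order_type A Q R b.
Proof.
  intros PQ E (f & Hlt & Hsurj & Hinj & Hord); exists f; repeat split.
  - intros x Hx; rewrite <- E; apply Hlt, PQ, Hx.
  - intros c Hc; rewrite <- E in Hc; destruct (Hsurj c Hc) as (x & Hx & Hf).
    exists x; split; [apply PQ, Hx | exact Hf].
  - intros x y Hx Hy; apply Hinj; apply PQ; assumption.
  - apply Hord; apply PQ; assumption.
  - apply Hord; apply PQ; assumption.
Qed.

Lemma order_type_total (A : Type) (P : A -> Prop) R a :
  has_order_type A P R a ->
  forall x y, P x -> P y -> R x y \/ x = y \/ R y x.
Proof.
  intros (f & _ & _ & Hinj & Hord) x y Hx Hy.
  destruct (ole_or_olt (f x) (f y)) as [H | H]; [| right; right; apply Hord; auto].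
  destruct (ole_or_olt (f y) (f x)) as [H' | H']; [| left; apply Hord; auto].
  right; left; apply Hinj; [exact Hx | exact Hy | split; assumption].
Qed.

(** When the first arguments differ, the second argument of one term has to be
    compared with the whole other term, whence the nested induction. *)
Lemma tlt_total n i : (i < n)%nat ->
  (forall x y, level n (S i) x -> level n (S i) y -> tlt x y \/ x = y \/ tlt y x) ->
  forall x y, level n i x -> level n i y -> tlt x y \/ x = y \/ tlt y x.
Proof.
  intros Hi Htot x; induction x as [| i1 al _ be IHbe]; intros y Hx.
  { destruct y; [tauto | left; constructor]. }
  induction y as [| i2 ga _ de IHde]; intros Hy; [right; right; constructor |].
  pose proof Hx as Hx'; pose proof Hy as Hy'.
  apply level_Theta in Hx', Hy'; trivial.
  destruct Hx' as (-> & Hal & Hbe), Hy' as (-> & Hga & Hde).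
  destruct (Htot al ga Hal Hga) as [H | [-> | H]].
  - destruct (IHbe (Theta i ga de) Hbe Hy) as [N | [-> | N]].
    + left; apply tlt_fst_lt; assumption.
    + right; right; apply tlt_fst_gt_eq, H.
    + right; right; apply tlt_fst_gt_lt; assumption.
  - destruct (IHbe de Hbe Hde) as [N | [-> | N]]; [left | tauto | right; right];
      apply tlt_fst_eq, N.
  - destruct (IHde Hde) as [N | [<- | N]].
    + left; apply tlt_fst_gt_lt; assumption.
    + left; apply tlt_fst_gt_eq, H.
    + right; right; apply tlt_fst_lt; assumption.
Qed.

Fixpoint value (g : term -> ord) (t : term) : ord :=
  match t with
  | Zero => ozero
  | Theta _ alpha beta => prefix_fun (g alpha) (value g beta)
  end.

Lemma value_Theta g i alpha beta :
  prefix (g alpha) (value g beta) (value g (Theta i alpha beta)).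
Proof. apply prefix_funP. Qed.

(** Only the letters are compared through the hypothesis on [g]; the induction
    on the derivation handles the tails. *)
Lemma value_olt n i (g : term -> ord) : (i < n)%nat ->
  (forall x y, level n (S i) x -> level n (S i) y -> tlt x y -> g x < g y) ->
  forall x y, tlt x y -> level n i x -> level n i y -> value g x < value g y.
Proof.
  intros Hi Hg x y H; induction H as
    [j al be | j k al be ga de Hjk | j al be ga de Hag _ Hbe IH
    | j al be de Hbd IH | j al be ga de Hga _ Hde IH | j al be ga Hga _]; intros Hx Hy.
  - eapply ole_olt_trans; [apply ozero_ole |].
    exact (prefix_ogt _ _ _ (value_Theta g j al be)).
  - apply level_Theta in Hx, Hy; trivial; lia.
  - pose proof Hy as Hy'; apply level_Theta in Hx, Hy'; trivial.
    destruct Hx as (_ & Hal & Hb), Hy' as (_ & Hgal & _).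
    pose proof (value_Theta g j ga de) as Hp.
    eapply prefix_olt_multiple; [apply value_Theta | | exact (IH Hb Hy)].
    eapply odvd_trans; [| exact (prefix_odvd _ _ _ Hp)].
    apply words_odvd, osucc_ole, Hg; assumption.
  - apply level_Theta in Hx, Hy; trivial.
    destruct Hx as (_ & _ & Hb), Hy as (_ & _ & Hd).
    exact (prefix_smono _ _ _ _ _ (value_Theta g j al be) (value_Theta g j al de)
      (IH Hb Hd)).
  - apply level_Theta in Hy; trivial; destruct Hy as (_ & _ & Hd).
    eapply olt_trans; [exact (IH Hx Hd) |].
    exact (prefix_ogt _ _ _ (value_Theta g j ga de)).
  - exact (prefix_ogt _ _ _ (value_Theta g j ga _)).
Qed.

(** One more level turns an alphabet of type [a] into its words.  Since [tlt] is
    total, its implication into the order of the ranks is an equivalence. *)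
Lemma level_order_type n i a : (i < n)%nat ->
  has_order_type term (level n (S i)) tlt a ->
  has_order_type term (level n i) tlt (words a).
Proof.
  intros Hi HT.
  pose proof (tlt_total n i Hi (order_type_total _ _ _ _ HT)) as Htot.
  destruct HT as (g & Hga & Hsurj & _ & Hord).
  assert (forall x y, tlt x y -> level n i x -> level n i y ->
    value g x < value g y) as Hval.
  { apply value_olt; [exact Hi |]; intros x y Hx Hy; apply Hord; assumption. }
  exists (value g); split; [| split; [| split]].
  - intros x; induction x as [| j al _ be IH]; intros Hx; [apply words_pos |].
    apply level_Theta in Hx; [| exact Hi]; destruct Hx as (_ & Hal & Hbe).
    eapply prefix_olt_multiple; [apply value_Theta | | exact (IH Hbe)].
    apply words_odvd, osucc_ole, Hga, Hal.
  - intros b; induction (olt_wf b) as [b _ IH]; intros Hb.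
    destruct (ozero_or_pos b) as [Z | Z].
    { exists Zero; split; [apply level_Zero | symmetry; exact Z]. }
    destruct (prefix_surjective a b Z Hb) as (c & x & Hca & Hxb & Hp).
    destruct (IH x Hxb (olt_trans _ _ _ Hxb Hb)) as (be & Hbe & Ebe).
    destruct (Hsurj c Hca) as (al & Hal & Eal).
    exists (Theta i al be); split; [apply level_Theta; auto |].
    pose proof (value_Theta g i al be) as Hq; rewrite Eal, Ebe in Hq.
    exact (prefix_unique _ _ _ _ Hq Hp).
  - intros x y Hx Hy E; destruct (Htot x y Hx Hy) as [H | [H | H]]; [| exact H |].
    + apply Hval in H; trivial; rewrite E in H; destruct (olt_irrefl _ H).
    + apply Hval in H; trivial; rewrite E in H; destruct (olt_irrefl _ H).
  - intros x y Hx Hy; split; [intros H; apply Hval; assumption | intros H].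
    destruct (Htot x y Hx Hy) as [N | [-> | N]]; [exact N | |].
    + destruct (olt_irrefl _ H).
    + apply Hval in N; trivial; destruct (olt_irrefl _ (olt_trans _ _ _ H N)).
Qed.

Lemma level_top_order_type n : has_order_type term (level n n) tlt oone.
Proof.
  exists (fun _ => ozero); split; [| split; [| split]].
  - intros x _; apply olt_oone; reflexivity.
  - intros b Hb; exists Zero; split; [apply level_Zero |].
    symmetry; apply olt_oone, Hb.
  - intros x y Hx Hy _; apply level_top in Hx, Hy; congruence.
  - intros x y Hx Hy; apply level_top in Hx, Hy; subst; split; intros H.
    + inversion H.
    + destruct (olt_irrefl _ H).
Qed.

Lemma omega_ole_tower k : omega <= omega_tower (S k).
Proof.
  rewrite <- omega_pow_oone; apply omega_pow_mono.
  destruct k as [| k]; cbn [omega_tower]; [reflexivity |].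
  apply osucc_ole, omega_pow_pos.
Qed.

(** Passing from level [i + 1 < n] to level [i] raises the type [a] to
    [omega^(omega^a)], two steps of the tower; level [n - 1], with the alphabet
    [{0}], has only the type [omega], which is why the count is odd. *)
Lemma level_order_type_tower n m i : (i + S m = n)%nat ->
  has_order_type term (level n i) tlt (omega_tower (S (2 * m))).
Proof.
  revert i; induction m as [| m IH]; intros i E.
  - assert (n = S i) as -> by lia.
    eapply has_order_type_ext; [reflexivity | |].
    2: { apply level_order_type; [lia | apply level_top_order_type]. }
    rewrite words_oone, <- omega_pow_oone; reflexivity.
  - eapply has_order_type_ext; [reflexivity | |].
    2: { apply level_order_type; [lia | apply (IH (S i)); lia]. }
    rewrite words_infinite by apply omega_ole_tower.
    replace (S (2 * S m))%nat with (S (S (S (2 * m)))) by lia; reflexivity.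
Qed.

Local Close Scope ord_scope.

Theorem corollary6 (n : nat) (hn : 1 <= n) :
  has_order_type term (OT0 n) tlt (omega_tower (2 * n - 1)).
Proof.
  destruct n as [| m]; [lia |].
  replace (2 * S m - 1)%nat with (S (2 * m)) by lia.
  eapply has_order_type_ext; [intros t; symmetry; apply OT0_level | reflexivity |].
  apply level_order_type_tower; reflexivity.
Qed.
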